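(* Let $G$ be a group with identity element $e$, let $R=\bigoplus_{\sigma\in G}R_\sigma$ be a $G$-graded ring, and let $M$ and $N$ be right $R_e$-modules. Then: (1) $N$ is an $M$-CS-Rickart right $R_e$-module if and only if $\mathrm{Coind}(N)$ is a $\mathrm{Coind}(M)$-CS-Rickart graded right $R$-module. (2) $N$ is a dual $M$-CS-Rickart right $R_e$-module if and only if $\mathrm{Ind}(N)$ is a dual $\mathrm{Ind}(M)$-CS-Rickart graded right $R$-module.
   Context: In an abelian category: a morphism $s:A\to B$ is a section (resp. $r:A\to B$ is a retraction) if there is $s':B\to A$ with $s's=1_A$ (resp. $r':B\to A$ with $rr'=1_B$). A monomorphism $f:X\to Y$ is essential if for every morphism $h:Y\to P$ such that $hf$ is a monomorphism, $h$ is a monomorphism. An epimorphism $f:X\to Y$ is superfluous if for every morphism $h:P\to X$ such that $fh$ is an epimorphism, $h$ is an epimorphism. For objects $M,N$ of an abelian category: $N$ is $M$-CS-Rickart if for every morphism $f:M\to N$ there are an essential monomorphism $u:\mathrm{Ker}(f)\to L$ and a section $s:L\to M$ with $\ker(f)=su$. $N$ is dual $M$-CS-Rickart if for every morphism $f:M\to N$ there are a retraction $r:N\to P$ and a superfluous epimorphism $t:P\to \mathrm{Coker}(f)$ with $\mathrm{coker}(f)=tr$. $\mathrm{gr}(R)$ is the (Grothendieck) category of $G$-graded unital right $R$-modules, with degree-preserving $R$-homomorphisms as morphisms; (dual) CS-Rickart notions for graded modules are understood in $\mathrm{gr}(R)$, and for right $R_e$-modules in $\mathrm{Mod}(R_e)$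 (right modules). The functor $\mathrm{Ind}:\mathrm{Mod}(R_e)\to \mathrm{gr}(R)$ sends $N$ to $N\otimes_{R_e}R$ with $\sigma$-component $N\otimes_{R_e}R_\sigma$ for $\sigma\in G$. The functor $\mathrm{Coind}:\mathrm{Mod}(R_e)\to \mathrm{gr}(R)$ sends $N$ to $\bigoplus_{\sigma\in G}M'_\sigma$, where $M'_\sigma=\{f\in \mathrm{Hom}_{R_e}(R,N)\mid f(R_{\sigma'})=0 \text{ for every } \sigma'\neq\sigma^{-1}\}$, with right $R$-action $(fr)(x)=f(rx)$. *)

(* Defs.v *)
From HB Require Import structures.
From mathcomp Require Import all_boot ssralg ssrint generic_quotient ring_quotient.
From mathcomp Require Import boolp functions.
From mathcomp.multinomials Require Import freeg.

Set Implicit Arguments.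
Unset Strict Implicit.
Unset Printing Implicit Defensive.

Import GRing.Theory.
Local Open Scope ring_scope.

(* The notions below only involve zero morphisms, kernels and cokernels, so they
   are stated for any category with zero morphisms; they are used in the abelian
   categories [Mod A] and [gr R]. *)

Record category := Category {
  ob :> Type;
  Hom : ob -> ob -> Type;
  idc : forall X, Hom X X;
  compc : forall X Y Z, Hom Y Z -> Hom X Y -> Hom X Z;
  zeroc : forall X Y, Hom X Y;
  compcA : forall W X Y Z (h : Hom Y Z) (g : Hom X Y) (f : Hom W X),
    compc h (compc g f) = compc (compc h g) f;
  comp1c : forall X Y (f : Hom X Y), compc (idc Y) f = f;
  compc1 : forall X Y (f : Hom X Y), compc f (idc X) = f;
  comp0c : forall X Y Z (f : Hom X Y), compc (zeroc Y Z) f = zeroc X Z;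
  compc0 : forall X Y Z (f : Hom Y Z), compc f (zeroc X Y) = zeroc X Z
}.

Arguments Hom {c} X Y.
Arguments idc {c} X.
Arguments compc {c X Y Z} g f.
Arguments zeroc {c} X Y.

Declare Scope cat_scope.
Delimit Scope cat_scope with cat.
Notation "g ∘ f" := (compc g f) (at level 40, left associativity) : cat_scope.

Section CSRickart.
Local Open Scope cat_scope.
Variable C : category.

Definition monomorphism (X Y : C) (f : Hom X Y) : Prop :=
  forall (Z : C) (g h : Hom Z X), f ∘ g = f ∘ h -> g = h.

Definition epimorphism (X Y : C) (f : Hom X Y) : Prop :=
  forall (Z : C) (g h : Hom Y Z), g ∘ f = h ∘ f -> g = h.

Definition is_section (A B : C) (s : Hom A B) : Prop :=
  exists s' : Hom B A, s' ∘ s = idc A.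

Definition is_retraction (A B : C) (r : Hom A B) : Prop :=
  exists r' : Hom B A, r ∘ r' = idc B.

Definition essential_mono (X Y : C) (f : Hom X Y) : Prop :=
  monomorphism f /\
  forall (P : C) (h : Hom Y P), monomorphism (h ∘ f) -> monomorphism h.

Definition superfluous_epi (X Y : C) (f : Hom X Y) : Prop :=
  epimorphism f /\
  forall (P : C) (h : Hom P X), epimorphism (f ∘ h) -> epimorphism h.

Definition is_kernel (M N K : C) (f : Hom M N) (k : Hom K M) : Prop :=
  f ∘ k = zeroc K N /\
  forall (X : C) (g : Hom X M), f ∘ g = zeroc X N ->
    exists! g' : Hom X K, k ∘ g' = g.

Definition is_cokernel (M N Q : C) (f : Hom M N) (q : Hom N Q) : Prop :=
  q ∘ f = zeroc M Q /\
  forall (X : C) (g : Hom N X), g ∘ f = zeroc M X ->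
    exists! g' : Hom Q X, g' ∘ q = g.

(* [CSRickart M N] : N is M-CS-Rickart. Kernels are unique up to a unique
   isomorphism, so the choice of [k = ker f] is immaterial. *)
Definition CSRickart (M N : C) : Prop :=
  forall f : Hom M N,
  exists (K : C) (k : Hom K M), is_kernel f k /\
  exists (L : C) (u : Hom K L) (s : Hom L M),
    [/\ essential_mono u, is_section s & k = s ∘ u].

(* [dualCSRickart M N] : N is dual M-CS-Rickart. *)
Definition dualCSRickart (M N : C) : Prop :=
  forall f : Hom M N,
  exists (Q : C) (q : Hom N Q), is_cokernel f q /\
  exists (P : C) (r : Hom N P) (t : Hom P Q),
    [/\ is_retraction r, superfluous_epi t & q = t ∘ r].

End CSRickart.

(* A right A-module is a left module over the converse ring [A^c]. *)
Notation rmodType A := (lmodType A^c).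

Definition ract (A : pzRingType) (M : rmodType A) (m : M) (a : A) : M :=
  (a : A^c) *: m.

Notation "m ⋅ a" := (ract m a) (at level 40, left associativity) : ring_scope.

Section RAct.
Variables (A : pzRingType) (M : rmodType A).
Implicit Types (m : M) (a b : A).

Lemma ractDl m m' a : (m + m') ⋅ a = m ⋅ a + m' ⋅ a.
Proof. exact: scalerDr. Qed.

Lemma ractDr m a b : m ⋅ (a + b) = m ⋅ a + m ⋅ b.
Proof. exact: scalerDl. Qed.

Lemma ractBl m m' a : (m - m') ⋅ a = m ⋅ a - m' ⋅ a.
Proof. exact: scalerBr. Qed.

Lemma ractA m a b : m ⋅ a ⋅ b = m ⋅ (a * b).
Proof. exact: scalerA. Qed.

Lemma ract1 m : m ⋅ 1 = m.
Proof. exact: scale1r. Qed.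

Lemma ract0l a : (0 : M) ⋅ a = 0.
Proof. exact: scaler0. Qed.

Lemma ract0r m : m ⋅ (0 : A) = 0.
Proof. exact: scale0r. Qed.

Lemma ract_suml I (r : seq I) (F : I -> M) a :
  (\sum_(i <- r) F i) ⋅ a = \sum_(i <- r) F i ⋅ a.
Proof. exact: scaler_sumr. Qed.

Lemma ract_sumr I (r : seq I) (F : I -> A) m :
  m ⋅ (\sum_(i <- r) F i) = \sum_(i <- r) m ⋅ F i.
Proof. exact: scaler_suml. Qed.

Lemma linear_ract (N : rmodType A) (f : {linear M -> N}) m a :
  f (m ⋅ a) = f m ⋅ a.
Proof. exact: linearZ. Qed.

End RAct.

Lemma linear_ext (A : pzRingType) (U V : lmodType A) (f g : {linear U -> V}) :
  f =1 g -> f = g.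
Proof.
case: f g => [f [[fD] [fZ]]] [g [[gD] [gZ]]] /= /funext efg.
move: gD gZ; rewrite -efg => gD gZ.
by rewrite (Prop_irrelevance gD fD) (Prop_irrelevance gZ fZ).
Qed.

Section ModCategory.
Variable A : pzRingType.
Implicit Types M N P : rmodType A.

Definition mod_id M : {linear M -> M} := idfun.

Definition mod_comp M N P (g : {linear N -> P}) (f : {linear M -> N}) :
  {linear M -> P} := (g \o f)%FUN.

Definition mod_zero M N : {linear M -> N} := \0.

Program Definition Mod : category :=
  @Category (rmodType A) (fun M N => {linear M -> N})
    mod_id mod_comp mod_zero _ _ _ _ _.
Next Obligation. exact: linear_ext. Qed.
Next Obligation. exact: linear_ext. Qed.
Next Obligation. exact: linear_ext. Qed.
Next Obligation. exact: linear_ext. Qed.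
Next Obligation. by apply: linear_ext => x /=; rewrite linear0. Qed.

End ModCategory.

Section DirectSum.
Variables (I : eqType) (V : zmodType).
Implicit Types (C : I -> V -> Prop) (s t : seq I) (c : I -> V).

Definition is_subgroup (D : V -> Prop) : Prop :=
  D 0 /\ forall x y, D x -> D y -> D (x - y).

Definition is_sum_of C (x : V) : Prop :=
  exists (s : seq I) (c : I -> V),
    [/\ uniq s, forall i, C i (c i) & x = \sum_(i <- s) c i].

(* V is the internal direct sum of the subgroups C i. *)
Definition is_direct_sum C : Prop :=
  [/\ forall i, is_subgroup (C i),
      forall x, is_sum_of C x
    & forall s c, uniq s -> (forall i, C i (c i)) -> \sum_(i <- s) c i = 0 ->
        forall i, i \in s -> c i = 0].

Lemma is_subgroupN (D : V -> Prop) x : is_subgroup D -> D x -> D (- x).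
Proof. by case=> D0 DB Dx; rewrite -sub0r; apply: DB. Qed.

Lemma is_subgroupD (D : V -> Prop) x y : is_subgroup D -> D x -> D y -> D (x + y).
Proof.
by move=> sD Dx Dy; rewrite -[y]opprK; apply: sD.2 => //; apply: is_subgroupN.
Qed.

Lemma is_subgroup_sum (D : V -> Prop) (J : Type) (r : seq J) (F : J -> V) :
  is_subgroup D -> (forall j, D (F j)) -> D (\sum_(j <- r) F j).
Proof.
move=> sD DF; apply: big_ind => //; first exact: sD.1.
by move=> x y; apply: is_subgroupD.
Qed.

Lemma sum_supp s t c : uniq s -> uniq t -> {subset s <= t} ->
  (forall i, i \notin s -> c i = 0) -> \sum_(i <- s) c i = \sum_(i <- t) c i.
Proof.
move=> us ut st c0; rewrite [RHS](bigID (mem s)) /= [X in _ + X]big1 // addr0.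
rewrite -[RHS]big_filter; apply: perm_big; apply: uniq_perm => //.
  exact: filter_uniq.
move=> i; rewrite mem_filter; apply/idP/andP => [si|[]//]; split=> //.
exact: st.
Qed.

Lemma is_sum_ofP C x : (forall i, is_subgroup (C i)) -> is_sum_of C x ->
  exists (s : seq I) (c : I -> V),
    [/\ uniq s, forall i, C i (c i), forall i, i \notin s -> c i = 0
      & x = \sum_(i <- s) c i].
Proof.
move=> sC [s [c [us Cc ->]]]; exists s, (fun i => if i \in s then c i else 0).
split=> //.
- by move=> i; case: ifP => // _; apply: (sC i).1.
- by move=> i /negbTE ->.
- by rewrite !big_seq; apply: eq_bigr => i ->.
Qed.

Lemma is_sum_of_subgroup C : (forall i, is_subgroup (C i)) ->
  is_subgroup (is_sum_of C).
Proof.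
move=> sC; split.
  by exists [::], (fun=> 0); split=> // [i|]; [apply: (sC i).1 | rewrite big_nil].
move=> x y /(is_sum_ofP sC)[s [c [us Cc c0 ->]]].
move=> /(is_sum_ofP sC)[t [d [ut Cd d0 ->]]].
exists (undup (s ++ t)), (fun i => c i - d i); split; first exact: undup_uniq.
  by move=> i; apply: (sC i).2.
rewrite sumrB (sum_supp us (undup_uniq (s ++ t))) //; last first.
  by move=> i si; rewrite mem_undup mem_cat si.
rewrite (sum_supp ut (undup_uniq (s ++ t))) //.
by move=> i ti; rewrite mem_undup mem_cat ti orbT.
Qed.

Lemma is_sum_of1 C i x : (forall j, is_subgroup (C j)) -> C i x -> is_sum_of C x.
Proof.
move=> sC Cx; exists [:: i], (fun j => if j == i then x else 0).
split=> //; last by rewrite big_seq1 eqxx.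
by move=> j; case: eqP => [->|_] //; apply: (sC j).1.
Qed.

Lemma is_direct_sum_by C (p : I -> V -> V) :
  (forall i, is_subgroup (C i)) -> (forall x, is_sum_of C x) ->
  (forall i, {morph p i : x y / x + y}) ->
  (forall i x, C i x -> p i x = x) ->
  (forall i j x, i != j -> C j x -> p i x = 0) ->
  is_direct_sum C.
Proof.
move=> sC genC pD pC p0; split=> // s c us Cc sc0 i si.
have pi0 : p i 0 = 0 by apply: pC; apply: (sC i).1.
have : p i (\sum_(j <- s) c j) = 0 by rewrite sc0.
rewrite (big_morph (p i) (pD i) pi0) (bigD1_seq i) //= big1 ?addr0 ?pC //.
by move=> j ji; apply: (p0 i j); rewrite // eq_sym.
Qed.

Section Projection.
Variables (C : I -> V -> Prop) (dC : is_direct_sum C).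

Let sC i : is_subgroup (C i). Proof. by case: dC. Qed.

Lemma dproj_subproof x : exists c : I -> V, (forall i, C i (c i)) /\
  exists s, [/\ uniq s, forall i, i \notin s -> c i = 0 & x = \sum_(i <- s) c i].
Proof.
have [_ gC _] := dC; have [s [c [us Cc c0 ->]]] := is_sum_ofP sC (gC x).
by exists c; split=> //; exists s.
Qed.

Definition dproj (i : I) (x : V) : V := sval (cid (dproj_subproof x)) i.

Lemma dproj_in i x : C i (dproj i x).
Proof. by rewrite /dproj; case: cid => c [] /=. Qed.

Lemma dproj_sum x : exists s,
  [/\ uniq s, forall i, i \notin s -> dproj i x = 0
    & x = \sum_(i <- s) dproj i x].
Proof. by rewrite /dproj; case: cid => c [] /=. Qed.

Lemma dproj_unique x s c : uniq s -> (forall i, C i (c i)) ->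
  (forall i, i \notin s -> c i = 0) -> x = \sum_(i <- s) c i ->
  forall i, dproj i x = c i.
Proof.
move=> us Cc c0 xE i; have [t [ut d0 xE']] := dproj_sum x.
have [_ _ iC] := dC; have uu := undup_uniq (s ++ t).
have su : {subset s <= undup (s ++ t)}.
  by move=> j sj; rewrite mem_undup mem_cat sj.
have tu : {subset t <= undup (s ++ t)}.
  by move=> j tj; rewrite mem_undup mem_cat tj orbT.
have H : \sum_(j <- undup (s ++ t)) (dproj j x - c j) = 0.
  rewrite sumrB -(sum_supp us uu su c0) -(sum_supp ut uu tu d0).
  by rewrite -xE -xE' subrr.
have [iu|] := boolP (i \in undup (s ++ t)).
  apply/subr0_eq; apply: (iC _ _ uu _ H) iu => j.
  by apply: (sC j).2 => //; apply: dproj_in.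
by rewrite mem_undup mem_cat negb_or => /andP[/c0-> /d0->].
Qed.

Lemma dproj_id i x : C i x -> dproj i x = x.
Proof.
move=> Cx; rewrite (@dproj_unique _ [:: i] (fun j => if j == i then x else 0)).
- by rewrite eqxx.
- by [].
- by move=> j; case: eqP => [->|_] //; apply: (sC j).1.
- by move=> j; rewrite inE => /negbTE->.
- by rewrite big_seq1 eqxx.
Qed.

Lemma dproj_neq i j x : i != j -> C j x -> dproj i x = 0.
Proof.
move=> /negbTE ij Cx.
rewrite (@dproj_unique _ [:: j] (fun i => if i == j then x else 0)).
- by rewrite ij.
- by [].
- by move=> k; case: eqP => [->|_] //; apply: (sC k).1.
- by move=> k; rewrite inE => /negbTE->.
- by rewrite big_seq1 eqxx.
Qed.

Lemma dprojD i : {morph dproj i : x y / x + y}.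
Proof.
move=> x y; have [s [us s0 xE]] := dproj_sum x; have [t [ut t0 yE]] := dproj_sum y.
apply: (@dproj_unique _ (undup (s ++ t)) (fun j => dproj j x + dproj j y)).
- exact: undup_uniq.
- by move=> j; apply: is_subgroupD => //; apply: dproj_in.
- move=> j; rewrite mem_undup mem_cat negb_or => /andP[/s0-> /t0->].
  by rewrite addr0.
- rewrite big_split /= [in LHS]xE [in LHS]yE; congr (_ + _); apply: sum_supp => //;
  by rewrite ?undup_uniq // => j; rewrite mem_undup mem_cat => ->; rewrite ?orbT.
Qed.

End Projection.
End DirectSum.

(* 1 \in R_e is not required: it is a consequence, see [rcomp1]. *)
Record gradedRing (G : groupType) := GradedRing {
  gring :> pzRingType;
  rcomp : G -> gring -> Prop;
  rcomp_direct : is_direct_sum rcomp;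
  rcompM : forall (σ τ : G) (x y : gring),
    rcomp σ x -> rcomp τ y -> rcomp (σ * τ)%g (x * y)
}.

Arguments rcomp {G g} σ x.

Record gradedModule (G : groupType) (R : gradedRing G) := GradedModule {
  gmod :> rmodType R;
  mcomp : G -> gmod -> Prop;
  mcomp_direct : is_direct_sum mcomp;
  mcompM : forall (σ τ : G) (m : gmod) (x : R),
    mcomp σ m -> rcomp τ x -> mcomp (σ * τ)%g (m ⋅ x)
}.

Arguments mcomp {G R g} σ m.

Section GrCategory.
Variables (G : groupType) (R : gradedRing G).
Implicit Types M N P : gradedModule R.

Record gr_hom M N := GrHom {
  gr_map :> {linear M -> N};
  gr_homP : forall (σ : G) (m : M), mcomp σ m -> mcomp σ (gr_map m)
}.

Lemma gr_hom_ext M N (f g : gr_hom M N) : gr_map f =1 gr_map g -> f = g.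
Proof.
case: f g => [f fp] [g gp] /= /linear_ext fg; move: gp; rewrite -fg => gp.
by rewrite (Prop_irrelevance fp gp).
Qed.

Definition gr_id M : gr_hom M M :=
  @GrHom M M (idfun : {linear M -> M}) (fun _ _ => id).

Definition gr_comp M N P (g : gr_hom N P) (f : gr_hom M N) : gr_hom M P :=
  @GrHom M P (g \o f : {linear M -> P})
    (fun σ m mσ => gr_homP g (gr_homP f mσ)).

Lemma gr_zero_subproof M N σ (m : M) :
  mcomp σ m -> mcomp σ ((\0 : {linear M -> N}) m).
Proof. by move=> _ /=; have [sN _ _] := mcomp_direct N; apply: (sN σ).1. Qed.

Definition gr_zero M N : gr_hom M N := GrHom (@gr_zero_subproof M N).

Program Definition gr : category :=
  @Category (gradedModule R) gr_hom gr_id gr_comp gr_zero _ _ _ _ _.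
Next Obligation. exact: gr_hom_ext. Qed.
Next Obligation. exact: gr_hom_ext. Qed.
Next Obligation. exact: gr_hom_ext. Qed.
Next Obligation. exact: gr_hom_ext. Qed.
Next Obligation. by apply: gr_hom_ext => x /=; rewrite linear0. Qed.

End GrCategory.

Arguments gr {G} R.

Section IdentityComponent.
Variables (G : groupType) (R : gradedRing G).

Lemma rcomp_subgroup (σ : G) : is_subgroup (@rcomp G R σ).
Proof. by have [sR _ _] := rcomp_direct R. Qed.

Definition rproj (σ : G) : R -> R := dproj (rcomp_direct R) σ.

Lemma rprojD σ : {morph rproj σ : x y / x + y}.
Proof. exact: dprojD. Qed.

Lemma rproj0 σ : rproj σ 0 = 0.
Proof. by apply: dproj_id; apply: (rcomp_subgroup σ).1. Qed.

Lemma rproj_in σ x : rcomp σ (rproj σ x).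
Proof. exact: dproj_in. Qed.

Lemma rproj_id σ x : rcomp σ x -> rproj σ x = x.
Proof. exact: dproj_id. Qed.

Lemma rproj_neq σ τ x : σ != τ -> rcomp τ x -> rproj σ x = 0.
Proof. exact: dproj_neq. Qed.

Lemma rproj_sum x : exists s : seq G,
  [/\ uniq s, forall σ, σ \notin s -> rproj σ x = 0
    & x = \sum_(σ <- s) rproj σ x].
Proof. exact: dproj_sum. Qed.

Lemma rcomp_ind (P : R -> Prop) : P 0 -> (forall x y, P x -> P y -> P (x + y)) ->
  (forall σ x, rcomp σ x -> P x) -> forall x, P x.
Proof.
move=> P0 PD Ph x; have [s [_ _ ->]] := rproj_sum x.
by apply: big_ind => // σ _; apply: Ph (rproj_in σ x).
Qed.

Lemma rproj_mull x y : rcomp 1%g x -> forall σ, rproj σ (x * y) = x * rproj σ y.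
Proof.
move=> x1 σ; elim/rcomp_ind: y => [|y z IHy IHz|τ y yτ].
- by rewrite mulr0 rproj0 mulr0.
- by rewrite mulrDr !rprojD IHy IHz mulrDr.
have xyτ : rcomp τ (x * y) by rewrite -[τ]mul1g; apply: rcompM.
have [->|στ] := eqVneq σ τ; first by rewrite !rproj_id.
by rewrite (rproj_neq στ xyτ) (rproj_neq στ yτ) mulr0.
Qed.

Lemma rcomp1 : rcomp 1%g (1 : R).
Proof.
suff H x : x = x * rproj 1%g 1 by rewrite [1]H mul1r; apply: rproj_in.
elim/rcomp_ind: x => [|x y IHx IHy|τ x xτ]; first by rewrite mul0r.
  by rewrite mulrDl -IHx -IHy.
have [s [us s0 E]] := rproj_sum 1.
rewrite -[LHS](rproj_id xτ) -[X in rproj τ X]mulr1 [X in _ * X]E mulr_sumr.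
rewrite (big_morph (rproj τ) (rprojD τ) (rproj0 τ)).
have xs σ : rcomp (τ * σ)%g (x * rproj σ 1) by apply: rcompM => //; apply: rproj_in.
have H0 σ : σ != 1%g -> rproj τ (x * rproj σ 1) = 0.
  move=> σ1; apply: rproj_neq (xs σ); apply: contra σ1 => /eqP E1.
  by apply/eqP/(mulgI τ); rewrite -E1 mulg1.
have [s1|s1] := boolP (1%g \in s).
  rewrite (bigD1_seq 1%g) //= big1 ?addr0 => [|σ]; last exact: H0.
  by rewrite rproj_id // -[X in rcomp X]mulg1.
rewrite (s0 _ s1) mulr0 big_seq big1 // => σ σs; apply: H0.
by apply: contra s1 => /eqP<-.
Qed.

Definition Re_pred : {pred R} := [pred x | `[< rcomp 1%g x >]].

Lemma Re_subring_closed : subring_closed Re_pred.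
Proof.
split=> [|x y|x y]; rewrite ?inE.
- by apply/asboolP; apply: rcomp1.
- by move=> /asboolP x1 /asboolP y1; apply/asboolP/(rcomp_subgroup 1%g).2.
- move=> /asboolP x1 /asboolP y1; apply/asboolP.
  by rewrite -[1%g]mulg1; apply: rcompM.
Qed.

HB.instance Definition _ := GRing.isSubringClosed.Build R Re_pred Re_subring_closed.

Record Re : Type := MkRe { Re_val : R; Re_valP : Re_val \in Re_pred }.

HB.instance Definition _ := [isSub for Re_val].
HB.instance Definition _ := [Choice of Re by <:].
HB.instance Definition _ :=
  GRing.SubChoice_isSubPzRing.Build R Re_pred Re (subringClosedP _).

Lemma Re_rcomp (a : Re) : rcomp 1%g (val a).
Proof. by apply/asboolP; exact: (valP a). Qed.

End IdentityComponent.

Section Coind.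
Variables (G : groupType) (R : gradedRing G) (N : rmodType (Re R)).
Implicit Types (σ τ : G).

(* [Re_hom f] : f belongs to Hom_{R_e}(R, N), for the right R_e-module R. *)
Definition Re_hom (f : R -> N) : Prop :=
  (forall x y, f (x + y) = f x + f y) /\
  (forall x (a : Re R), f (x * val a) = f x ⋅ a).

(* The subgroup M'_σ of Hom_{R_e}(R, N). *)
Definition coind_hcomp σ (f : R -> N) : Prop :=
  Re_hom f /\ forall σ' x, σ' <> σ^-1%g -> rcomp σ' x -> f x = 0.

(* The direct sum of the M'_σ is their (internal) sum in Hom_{R_e}(R, N). *)
Definition coind_pred : {pred R -> N} := [pred f | `[< is_sum_of coind_hcomp f >]].

Lemma Re_hom_subgroup : is_subgroup Re_hom.
Proof.
split; first by split=> [x y|x a]; rewrite /= ?addr0 ?ract0l.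
move=> f g [fD fZ] [gD gZ]; split=> [x y|x a] /=.
  by rewrite [LHS]/GRing.add /= [X in _ + X]/GRing.opp /= fD gD opprD addrACA.
by rewrite [LHS]/GRing.add /= [X in _ + X]/GRing.opp /= fZ gZ -ractBl.
Qed.

Lemma coind_hcomp_subgroup σ : is_subgroup (coind_hcomp σ).
Proof.
split; first by split; [exact: Re_hom_subgroup.1|].
move=> f g [fH f0] [gH g0]; split; first exact: Re_hom_subgroup.2.
move=> σ' x σσ' xσ'; rewrite [LHS]/GRing.add /= [X in _ + X]/GRing.opp /=.
by rewrite (f0 _ _ σσ' xσ') (g0 _ _ σσ' xσ') subrr.
Qed.

Lemma coind_zmod_closed : zmod_closed coind_pred.
Proof.
have [c0 cB] := is_sum_of_subgroup coind_hcomp_subgroup.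
split=> [|f g]; rewrite ?inE; first exact/asboolP.
by move=> /asboolP fc /asboolP gc; apply/asboolP/cB.
Qed.

HB.instance Definition _ :=
  GRing.isZmodClosed.Build (R -> N) coind_pred coind_zmod_closed.

Record coind : Type := MkCoind { coind_val : R -> N; _ : coind_val \in coind_pred }.

HB.instance Definition _ := [isSub for coind_val].
HB.instance Definition _ := [Choice of coind by <:].
HB.instance Definition _ := [SubChoice_isSubZmodule of coind by <:].

Lemma coind_act_hcomp σ τ (f : R -> N) r : coind_hcomp σ f -> rcomp τ r ->
  coind_hcomp (σ * τ)%g (fun x => f (r * x)).
Proof.
move=> [[fD fZ] f0] rτ; split.
  by split=> [x y|x a]; rewrite ?mulrDr // mulrA fZ.
move=> σ' x σσ' xσ'; apply: (f0 (τ * σ')%g); last exact: rcompM.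
by apply: contra_not σσ' => E; rewrite invgM -E mulKg.
Qed.

Lemma coind_act_subproof (f : R -> N) r : f \in coind_pred ->
  (fun x => f (r * x)) \in coind_pred.
Proof.
rewrite !inE => /asboolP[s [c [us Hc ->]]]; apply/asboolP.
have sS := is_sum_of_subgroup coind_hcomp_subgroup.
have -> : (fun x => (\sum_(σ <- s) c σ) (r * x)) =
    \sum_(σ <- s) (fun x => c σ (r * x)).
  by apply/funext => x; rewrite !fct_sumE.
apply: is_subgroup_sum => // σ; have [t [ut _ rE]] := rproj_sum r.
have -> : (fun x => c σ (r * x)) = \sum_(τ <- t) (fun x => c σ (rproj τ r * x)).
  apply/funext => x; rewrite fct_sumE [in LHS]rE mulr_suml.
  have [[cD cZ] _] := Hc σ; apply: (big_morph (c σ)) => //.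
  by apply: (addrI (c σ 0)); rewrite -cD !addr0.
apply: is_subgroup_sum => // τ.
apply: (@is_sum_of1 _ _ _ (σ * τ)%g) => //; first exact: coind_hcomp_subgroup.
by apply: coind_act_hcomp => //; apply: rproj_in.
Qed.

(* The right action (f r)(x) = f (r x). *)
Definition coind_act (r : R^c) (f : coind) : coind :=
  MkCoind (coind_act_subproof r (valP f)).

Lemma coind_actA r r' (f : coind) : coind_act r (coind_act r' f) = coind_act (r * r') f.
Proof. by apply/val_inj/funext => x /=; rewrite mulrA. Qed.

Lemma coind_act1 : left_id 1 coind_act.
Proof. by move=> f; apply/val_inj/funext => x /=; rewrite mul1r. Qed.

Lemma coind_actDr : right_distributive coind_act +%R.
Proof. by move=> r f g; apply/val_inj/funext. Qed.

Lemma coind_hom (f : coind) : Re_hom (val f).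
Proof.
have /asboolP[s [c [_ Hc ->]]] := valP f.
by apply: is_subgroup_sum => [|σ]; [exact: Re_hom_subgroup | have [] := Hc σ].
Qed.

Lemma coind_actDl (f : coind) : {morph coind_act^~ f : r r' / r + r'}.
Proof.
move=> r r'; apply/val_inj/funext => x /=; have [fD _] := coind_hom f.
by rewrite mulrDl fD.
Qed.

HB.instance Definition _ := GRing.Zmodule_isLmodule.Build R^c coind
  coind_actA coind_act1 coind_actDr coind_actDl.

Definition coind_comp σ (f : coind) : Prop := coind_hcomp σ (val f).

Lemma coind_direct : is_direct_sum coind_comp.
Proof.
have sC σ : is_subgroup (coind_comp σ).
  have [c0 cB] := coind_hcomp_subgroup σ.
  by split=> [|f g]; rewrite /coind_comp ?raddf0 // raddfB; apply: cB.
split=> //.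
  move=> f; have /asboolP[s [c [us Hc fE]]] := valP f.
  have Hc' σ : c σ \in coind_pred.
    by apply/asboolP/(is_sum_of1 _ (Hc σ)); exact: coind_hcomp_subgroup.
  exists s, (fun σ => MkCoind (Hc' σ)); split=> //.
  by apply: val_inj; rewrite raddf_sum.
move=> s c us Hc sc0 σ σs; apply/val_inj/funext => x /=.
elim/rcomp_ind: x => [|x y IHx IHy|τ x xτ].
- have [cD _] := coind_hom (c σ).
  by apply: (addrI (val (c σ) 0)); rewrite -cD !addr0.
- have [cD _] := coind_hom (c σ).
  exact: etrans (cD x y) (etrans (congr2 +%R IHx IHy) (addr0 0)).
have [Eτ|/eqP/(proj2 (Hc σ))] := eqVneq τ σ^-1%g; last exact.
have /(congr1 (fun f : coind => val f x)) := sc0.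
rewrite raddf_sum /= fct_sumE (bigD1_seq σ) //= big1 ?addr0 // => ρ ρσ.
have [_ /(_ τ x)] := Hc ρ; apply=> //; rewrite Eτ => /invg_inj E.
by rewrite E eqxx in ρσ.
Qed.

Lemma coind_compM σ τ (f : coind) (r : R) :
  coind_comp σ f -> rcomp τ r -> coind_comp (σ * τ)%g (f ⋅ r).
Proof. exact: coind_act_hcomp. Qed.

Definition Coind : gradedModule R := GradedModule coind_direct coind_compM.

End Coind.

Section Tensor.
Variables (A : pzRingType) (N : rmodType A) (X : lmodType A).
Local Open Scope quotient_scope.

Inductive tensor_rel : {freeg (N * X)} -> Prop :=
| TensorRel0 : tensor_rel 0
| TensorRelB u v : tensor_rel u -> tensor_rel v -> tensor_rel (u - v)
| TensorRelDl n n' x :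
    tensor_rel (<< (n + n', x) >> - << (n, x) >> - << (n', x) >>)
| TensorRelDr n x x' :
    tensor_rel (<< (n, x + x') >> - << (n, x) >> - << (n, x') >>)
| TensorRelA n a x : tensor_rel (<< (n ⋅ a, x) >> - << (n, a *: x) >>).

Definition tensor_pred : {pred {freeg (N * X)}} := [pred u | `[< tensor_rel u >]].

Lemma tensor_zmod_closed : zmod_closed tensor_pred.
Proof.
split=> [|u v]; rewrite ?inE; first exact/asboolP/TensorRel0.
by move=> /asboolP ru /asboolP rv; apply/asboolP/TensorRelB.
Qed.

HB.instance Definition _ :=
  GRing.isZmodClosed.Build {freeg (N * X)} tensor_pred tensor_zmod_closed.

Definition tensor : Type := {ideal_quot tensor_pred}.

HB.instance Definition _ := GRing.Zmodule.on tensor.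

Definition tmk (n : N) (x : X) : tensor :=
  \pi_{ideal_quot tensor_pred} << (n, x) >>.

Local Notation "n ⊗ x" := (tmk n x) (at level 40).

Lemma tensor_eqP (u v : {freeg (N * X)}) : tensor_rel (u - v) ->
  \pi_{ideal_quot tensor_pred} u = \pi_{ideal_quot tensor_pred} v.
Proof. by move=> /asboolP uv; apply/eqP; rewrite -Quotient.idealrBE. Qed.

Lemma tmkDl n n' x : (n + n') ⊗ x = n ⊗ x + n' ⊗ x.
Proof.
rewrite /tmk -[RHS](raddfD \pi_{ideal_quot tensor_pred}).
by apply: tensor_eqP; rewrite opprD addrA; apply: TensorRelDl.
Qed.

Lemma tmkDr n x x' : n ⊗ (x + x') = n ⊗ x + n ⊗ x'.
Proof.
rewrite /tmk -[RHS](raddfD \pi_{ideal_quot tensor_pred}).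
by apply: tensor_eqP; rewrite opprD addrA; apply: TensorRelDr.
Qed.

Lemma tmkA n a x : (n ⋅ a) ⊗ x = n ⊗ (a *: x).
Proof. by apply: tensor_eqP; apply: TensorRelA. Qed.

Lemma tmk0r n : n ⊗ 0 = 0.
Proof. by apply: (addrI (n ⊗ 0)); rewrite -tmkDr !addr0. Qed.

Lemma tmk0l x : 0 ⊗ x = 0.
Proof. by apply: (addrI (0 ⊗ x)); rewrite -tmkDl !addr0. Qed.

Lemma tmkNl n x : (- n) ⊗ x = - (n ⊗ x).
Proof. by apply/eqP; rewrite -addr_eq0 -tmkDl addNr tmk0l. Qed.

Lemma tensor_sum (t : tensor) :
  exists s : seq (N * X), t = \sum_(p <- s) p.1 ⊗ p.2.
Proof.
pose P t := exists s : seq (N * X), t = \sum_(p <- s) p.1 ⊗ p.2.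
have P0 : P 0 by exists [::]; rewrite big_nil.
have PD t1 t2 : P t1 -> P t2 -> P (t1 + t2).
  by move=> [s1 ->] [s2 ->]; exists (s1 ++ s2); rewrite big_cat.
have PN t1 : P t1 -> P (- t1).
  move=> [s ->]; exists [seq (- p.1, p.2) | p <- s].
  by rewrite big_map -sumrN; apply: eq_bigr => p _; rewrite tmkNl.
have PMn t1 k : P t1 -> P (t1 *+ k).
  by move=> Pt; elim: k => [|k IHk]; rewrite ?mulr0n // mulrS; apply: PD.
have Ppure n x : P (n ⊗ x) by exists [:: (n, x)]; rewrite big_seq1.
rewrite -/(P t) -[t]reprK -[repr t]freeg_sumE raddf_sum; apply: big_ind => //.
move=> [n x] _; rewrite -[coeff _ _]intz -freegU_mulz raddfMz.
case: (coeff _ _) => k; rewrite ?NegzE ?mulrNz -pmulrn; last apply: PN.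
  exact/PMn/Ppure.
exact/PMn/Ppure.
Qed.

Lemma tensor_ext (B : zmodType) (f g : tensor -> B) :
  {morph f : t u / t + u} -> {morph g : t u / t + u} ->
  (forall n x, f (n ⊗ x) = g (n ⊗ x)) -> f =1 g.
Proof.
move=> fD gD fg t; have [s ->] := tensor_sum t.
have f0 : f 0 = 0 by apply: (addrI (f 0)); rewrite -fD !addr0.
have g0 : g 0 = 0 by apply: (addrI (g 0)); rewrite -gD !addr0.
rewrite (big_morph f fD f0) (big_morph g gD g0).
by apply: eq_bigr => p _; apply: fg.
Qed.

Section Lift.
Variables (B : zmodType) (β : N -> X -> B).
Hypothesis βDl : forall n n' x, β (n + n') x = β n x + β n' x.
Hypothesis βDr : forall n x x', β n (x + x') = β n x + β n x'.
Hypothesis βA : forall n a x, β (n ⋅ a) x = β n (a *: x).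

Let φ (u : {freeg (N * X)}) : B := fglift (fun p => β p.1 p.2 : zmodule B) u.

Let φB u v : φ (u - v) = φ u - φ v.
Proof. exact: (lift_is_additive (fun p => β p.1 p.2 : zmodule B)). Qed.

Let φ0 : φ 0 = 0.
Proof. by have := φB 0 0; rewrite !subrr. Qed.

Let φD u v : φ (u + v) = φ u + φ v.
Proof.
by rewrite -[v in LHS]opprK -[- v in LHS]sub0r !φB φ0 sub0r opprK.
Qed.

Let φU n x : φ << (n, x) >> = β n x.
Proof. by rewrite /φ liftU scale1r. Qed.

Let φ_rel u : tensor_rel u -> φ u = 0.
Proof.
elim=> {u} [|u v _ φu _ φv|n n' x|n x x'|n a x].
- exact: φ0.
- by rewrite φB φu φv subrr.
- by rewrite !φB !φU βDl -addrA -opprD subrr.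
- by rewrite !φB !φU βDr -addrA -opprD subrr.
- by rewrite φB !φU βA subrr.
Qed.

Definition tensor_lift (t : tensor) : B := φ (repr t).

Lemma tensor_lift_pi u : tensor_lift (\pi_{ideal_quot tensor_pred} u) = φ u.
Proof.
apply/eqP; rewrite -subr_eq0 -φB; apply/eqP/φ_rel/asboolP.
suff : repr (\pi_{ideal_quot tensor_pred} u) - u \in tensor_pred by [].
by rewrite Quotient.idealrBE reprK.
Qed.

Lemma tensor_lift_tmk n x : tensor_lift (n ⊗ x) = β n x.
Proof. by rewrite tensor_lift_pi φU. Qed.

Lemma tensor_liftD : {morph tensor_lift : t u / t + u}.
Proof.
move=> t u; rewrite -[t]reprK -[u]reprK -raddfD.
by rewrite [LHS]tensor_lift_pi φD -!tensor_lift_pi.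
Qed.

End Lift.
End Tensor.

Notation "n ⊗ x" := (tmk n x) (at level 40) : ring_scope.

Section Ind.
Variables (G : groupType) (R : gradedRing G).

Definition leftRe : Type := R.

HB.instance Definition _ := GRing.Zmodule.on leftRe.

Definition leftRe_scale (a : Re R) (x : leftRe) : leftRe := val a * (x : R).

Lemma leftRe_scaleA a b x :
  leftRe_scale a (leftRe_scale b x) = leftRe_scale (a * b) x.
Proof. exact: mulrA. Qed.

Lemma leftRe_scale1 : left_id 1 leftRe_scale.
Proof. exact: mul1r. Qed.

Lemma leftRe_scaleDr : right_distributive leftRe_scale +%R.
Proof. by move=> a x y; exact: mulrDr. Qed.

Lemma leftRe_scaleDl x : {morph leftRe_scale^~ x : a b / a + b}.
Proof. by move=> a b; exact: mulrDl. Qed.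

HB.instance Definition _ := GRing.Zmodule_isLmodule.Build (Re R) leftRe
  leftRe_scaleA leftRe_scale1 leftRe_scaleDr leftRe_scaleDl.

Variable N : rmodType (Re R).

Definition ind : Type := tensor N leftRe.

HB.instance Definition _ := GRing.Zmodule.on ind.

(* The right action (n ⊗ x) r = n ⊗ (x r). *)
Definition ind_act (r : R^c) (t : ind) : ind :=
  tensor_lift (fun (n : N) (x : leftRe) => n ⊗ ((x : R) * (r : R) : leftRe)) t.

Lemma ind_act_tmk r n (x : leftRe) :
  ind_act r (n ⊗ x) = n ⊗ ((x : R) * (r : R) : leftRe).
Proof.
apply: tensor_lift_tmk => [n1 n2 y|n1 y z|n1 a y]; first exact: tmkDl.
  by rewrite -tmkDr; congr (_ ⊗ _); exact: mulrDl.
by rewrite tmkA; congr (_ ⊗ _); rewrite /GRing.scale /= /leftRe_scale mulrA.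
Qed.

Lemma ind_actDr : right_distributive ind_act +%R.
Proof.
move=> r t u; apply: tensor_liftD => [n1 n2 y|n1 y z|n1 a y]; first exact: tmkDl.
  by rewrite -tmkDr; congr (_ ⊗ _); exact: mulrDl.
by rewrite tmkA; congr (_ ⊗ _); rewrite /GRing.scale /= /leftRe_scale mulrA.
Qed.

Lemma ind_actA r r' t : ind_act r (ind_act r' t) = ind_act (r * r') t.
Proof.
move: t; apply: tensor_ext => [t u|t u|n x]; rewrite ?ind_actDr //.
by rewrite !ind_act_tmk -mulrA.
Qed.

Lemma ind_act1 : left_id 1 ind_act.
Proof.
apply: tensor_ext => [t u|//|n x]; first by rewrite ind_actDr.
by rewrite ind_act_tmk mulr1.
Qed.

Lemma ind_actDl t : {morph ind_act^~ t : r r' / r + r'}.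
Proof.
move=> r r'; move: t; apply: tensor_ext => [t u|t u|n x].
- by rewrite ind_actDr.
- by rewrite !ind_actDr addrACA.
- by rewrite !ind_act_tmk -tmkDr; congr (_ ⊗ _); exact: mulrDr.
Qed.

HB.instance Definition _ := GRing.Zmodule_isLmodule.Build R^c ind
  ind_actA ind_act1 ind_actDr ind_actDl.

(* The σ-component N ⊗ R_σ, as a subgroup of N ⊗ R: R_σ is a direct summand of
   the left R_e-module R, so N ⊗ R_σ embeds in N ⊗ R, with image the set of
   sums of pure tensors n ⊗ x with x in R_σ. *)
Definition ind_comp (σ : G) (t : ind) : Prop :=
  exists s : seq (N * leftRe),
    (forall p, p \in s -> rcomp σ (p.2 : R)) /\ t = \sum_(p <- s) p.1 ⊗ p.2.

Definition ind_proj (σ : G) (t : ind) : ind :=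
  tensor_lift (fun (n : N) (x : leftRe) => n ⊗ (rproj σ (x : R) : leftRe)) t.

Lemma ind_proj_tmk σ n (x : leftRe) :
  ind_proj σ (n ⊗ x) = n ⊗ (rproj σ (x : R) : leftRe).
Proof.
apply: tensor_lift_tmk => [n1 n2 y|n1 y z|n1 a y]; first exact: tmkDl.
  by rewrite -tmkDr; congr (_ ⊗ _); exact: rprojD.
by rewrite tmkA; congr (_ ⊗ _); rewrite [RHS]rproj_mull //; apply: Re_rcomp.
Qed.

Lemma ind_projD σ : {morph ind_proj σ : t u / t + u}.
Proof.
move=> t u; apply: tensor_liftD => [n1 n2 y|n1 y z|n1 a y]; first exact: tmkDl.
  by rewrite -tmkDr; congr (_ ⊗ _); exact: rprojD.
by rewrite tmkA; congr (_ ⊗ _); rewrite [RHS]rproj_mull //; apply: Re_rcomp.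
Qed.

Lemma ind_proj0 σ : ind_proj σ 0 = 0.
Proof. by apply: (addrI (ind_proj σ 0)); rewrite -ind_projD !addr0. Qed.

Lemma ind_comp_subgroup σ : is_subgroup (ind_comp σ).
Proof.
split; first by exists [::]; split=> //; rewrite big_nil.
move=> t u [s [sσ ->]] [s' [s'σ ->]].
exists (s ++ [seq (- p.1, p.2) | p <- s']); split.
  by move=> p; rewrite mem_cat => /orP[/sσ//|/mapP[q /s'σ qσ ->]].
rewrite big_cat big_map -sumrN; congr (_ + _).
by apply: eq_bigr => p _; rewrite tmkNl.
Qed.

Lemma ind_comp_tmk σ n (x : leftRe) : rcomp σ (x : R) -> ind_comp σ (n ⊗ x).
Proof.
move=> xσ; exists [:: (n, x)]; split; last by rewrite big_seq1.
by move=> p; rewrite inE => /eqP->.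
Qed.

Lemma ind_direct : is_direct_sum ind_comp.
Proof.
apply: (@is_direct_sum_by _ _ _ ind_proj).
- exact: ind_comp_subgroup.
- move=> t; have [s ->] := tensor_sum t.
  apply: is_subgroup_sum => [|[n x]].
    exact: is_sum_of_subgroup ind_comp_subgroup.
  have [r [_ _ xE]] := rproj_sum (x : R).
  have -> : n ⊗ x = \sum_(σ <- r) n ⊗ (rproj σ (x : R) : leftRe).
    rewrite [in LHS]xE; apply: (big_morph (tmk n)); first exact: tmkDr.
    exact: tmk0r.
  apply: is_subgroup_sum => [|σ].
    exact: is_sum_of_subgroup ind_comp_subgroup.
  apply: (@is_sum_of1 _ _ _ σ); first exact: ind_comp_subgroup.
  by apply: ind_comp_tmk; apply: rproj_in.
- exact: ind_projD.
- move=> σ t [s [sσ ->]].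
  rewrite (big_morph _ (ind_projD σ) (ind_proj0 σ)) !big_seq.
  by apply: eq_bigr => p ps; rewrite ind_proj_tmk rproj_id //; apply: sσ.
- move=> σ τ t στ [s [sτ ->]].
  rewrite (big_morph _ (ind_projD σ) (ind_proj0 σ)) big_seq big1 // => p ps.
  by rewrite ind_proj_tmk (rproj_neq στ (sτ _ ps)) tmk0r.
Qed.

Lemma ind_compM σ τ (t : ind) (r : R) :
  ind_comp σ t -> rcomp τ r -> ind_comp (σ * τ)%g (t ⋅ r).
Proof.
move=> [s [sσ ->]] rτ; rewrite ract_suml big_seq.
apply: (big_ind (ind_comp (σ * τ)%g)).
- exact: (ind_comp_subgroup _).1.
- by move=> t1 t2; apply: is_subgroupD; apply: ind_comp_subgroup.
- move=> p ps; rewrite [_ ⋅ _]ind_act_tmk; apply: ind_comp_tmk.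
  by apply: rcompM => //; apply: sσ.
Qed.

Definition Ind : gradedModule R := GradedModule ind_direct ind_compM.

End Ind.

(* Main.v *)
(** The functor [X ↦ X_e] from [gr R] to [Mod R_e] has the left adjoint [Ind] and
    the right adjoint [Coind], with invertible unit [N → Ind(N)_e] and counit
    [Coind(N)_e → N].  Let [E] be any functor preserving zero morphisms that has a
    left adjoint, and a right adjoint [H] with invertible counit.  Then [E] preserves
    monomorphisms and kernels, and [H] is fully faithful and preserves kernels and
    sections.  Moreover [H] preserves essential monomorphisms, since [h] with source
    [H L] is mono as soon as [E h] is; and [E u] is essential for every essential
    [u : K → L] such that [K] embeds into some [H M].  So kernel factorizations are
    carried over by [H] in one direction and by [E] in the other, which is (1); and
    (2) is the same statement in the opposite categories. *)
From HB Require Import structures.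
Require Import Defs.
From mathcomp Require Import all_boot ssralg.
From mathcomp Require Import boolp functions.

Set Implicit Arguments.
Unset Strict Implicit.
Unset Printing Implicit Defensive.

Import GRing.Theory.

(** * Monomorphisms, sections, isomorphisms and kernels *)

Section Isomorphism.
Local Open Scope cat_scope.
Variable C : category.

Definition isomorphism (X Y : C) (f : Hom X Y) : Prop :=
  exists g : Hom Y X, g ∘ f = idc X /\ f ∘ g = idc Y.

Lemma mono_comp (X Y Z : C) (g : Hom Y Z) (f : Hom X Y) :
  monomorphism g -> monomorphism f -> monomorphism (g ∘ f).
Proof. by move=> gm fm W a b; rewrite -!compcA => /gm/fm. Qed.

Lemma mono_compr (X Y Z : C) (g : Hom Y Z) (f : Hom X Y) :
  monomorphism (g ∘ f) -> monomorphism f.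
Proof. by move=> gfm W a b ab; apply: gfm; rewrite -!compcA ab. Qed.

Lemma section_mono (X Y : C) (s : Hom X Y) : is_section s -> monomorphism s.
Proof.
by move=> [s' s's]; apply: (@mono_compr _ _ _ s'); rewrite s's => Z a b; rewrite !comp1c.
Qed.

Lemma iso_mono (X Y : C) (f : Hom X Y) : isomorphism f -> monomorphism f.
Proof. by move=> [g [gf _]]; apply: section_mono; exists g. Qed.

Lemma kernel_mono (M N K : C) (f : Hom M N) (k : Hom K M) :
  is_kernel f k -> monomorphism k.
Proof.
move=> [fk0 univ] Z a b kab.
have [|c [_ c_uniq]] := univ Z (k ∘ a); first by rewrite compcA fk0 comp0c.
by rewrite -(c_uniq a) // -(c_uniq b).
Qed.

End Isomorphism.

(** * Transfer of the CS-Rickart property along adjunctions *)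

Record zfunctor (C D : category) := ZFunctor {
  fob :> C -> D;
  fmap : forall X Y : C, Hom X Y -> Hom (fob X) (fob Y);
  fmap1 : forall X, fmap (idc X) = idc (fob X);
  fmapM : forall X Y Z (g : Hom Y Z) (f : Hom X Y),
    fmap (compc g f) = compc (fmap g) (fmap f);
  fmap0 : forall X Y, fmap (zeroc X Y) = zeroc (fob X) (fob Y)
}.

Section UniversalArrows.
Local Open Scope cat_scope.
Variables (C D : category) (E : zfunctor C D).

(** Adjoints are given object by object through universal arrows, so that their action on morphisms
    never has to be constructed. *)
Definition universal_arrow (N : D) (F : C) (η : Hom N (E F)) : Prop :=
  forall (X : C) (f : Hom N (E X)), exists! g : Hom F X, fmap E g ∘ η = f.

Definition couniversal_arrow (N : D) (H : C) (ε : Hom (E H) N) : Prop :=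
  forall (X : C) (f : Hom (E X) N), exists! g : Hom X H, ε ∘ fmap E g = f.

Section LeftAdjoint.
Hypothesis E_left_adjoint :
  forall N : D, exists (F : C) (η : Hom N (E F)), universal_arrow η.

(** Arrows [a], [b] into [E X] transpose to arrows [a'], [b'] into [X]. If [E f] identifies [a] and
    [b], then [f ∘ a'] and [f ∘ b'] have the same transpose, so they agree. *)
Lemma fmap_mono (X Y : C) (f : Hom X Y) :
  monomorphism f -> monomorphism (fmap E f).
Proof.
move=> fm Z a b; have [F [η univ]] := E_left_adjoint Z.
have [a' [<- _]] := univ _ a; have [b' [<- _]] := univ _ b.
rewrite !compcA -!fmapM => ab; congr (fmap E _ ∘ _); apply: fm.
have [c [_ c_uniq]] := univ _ (fmap E (f ∘ b') ∘ η).
by rewrite -(c_uniq _ ab) -(c_uniq (f ∘ b')).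
Qed.

(** An arrow killed by [E f] transposes to one killed by [f], because the zero morphism transposes
    to zero. That one factors through [k], and the factorization transposes back. *)
Lemma fmap_kernel (M N K : C) (f : Hom M N) (k : Hom K M) :
  is_kernel f k -> is_kernel (fmap E f) (fmap E k).
Proof.
move=> kerk; have [fk0 kuniv] := kerk.
split=> [|Z a]; first by rewrite -fmapM fk0 fmap0.
have [F [η univ]] := E_left_adjoint Z.
have [a' [<- _]] := univ _ a; rewrite compcA -fmapM => fa0.
have {}fa0 : f ∘ a' = zeroc F N.
  have [c [_ c_uniq]] := univ _ (zeroc Z (E N)).
  by rewrite -(c_uniq _ fa0) -(c_uniq (zeroc F N)) // fmap0 comp0c.
have [b [kb _]] := kuniv _ _ fa0.
exists (fmap E b ∘ η); split=> [|c kc]; first by rewrite compcA -fmapM kb.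
by apply: (fmap_mono (kernel_mono kerk)); rewrite kc compcA -fmapM kb.
Qed.

Section RightAdjoint.
Variables (H : D -> C) (ε : forall N : D, Hom (E (H N)) N).
Hypothesis ε_univ : forall N, couniversal_arrow (ε N).
Hypothesis ε_iso : forall N, isomorphism (ε N).

Lemma couniversal_inj (X : C) (N : D) (a b : Hom X (H N)) :
  ε N ∘ fmap E a = ε N ∘ fmap E b -> a = b.
Proof.
have [c [_ c_uniq]] := ε_univ (ε N ∘ fmap E b) => ab.
by rewrite -(c_uniq _ ab) -(c_uniq b).
Qed.

(** The two square equations say that [f'] and [k'] are the images of [f] and [k] under the right
    adjoint. The factorization through [k'] is the transpose of the one through [k]. *)
Lemma kernel_transpose (M N K : D) (f : Hom M N) (k : Hom K M)
    (f' : Hom (H M) (H N)) (k' : Hom (H K) (H M)) :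
  ε N ∘ fmap E f' = f ∘ ε M -> ε M ∘ fmap E k' = k ∘ ε K ->
  is_kernel f k -> is_kernel f' k'.
Proof.
move=> f'E k'E kerk; have [fk0 kuniv] := kerk; split=> [|X g f'g].
  apply: couniversal_inj.
  by rewrite fmapM compcA f'E -compcA k'E compcA fk0 comp0c fmap0 compc0.
have [|b [kb _]] := kuniv _ (ε M ∘ fmap E g).
  by rewrite compcA -f'E -compcA -fmapM f'g fmap0 compc0.
have [c [cE _]] := ε_univ b; exists c; split=> [|d kd]; apply: couniversal_inj.
  by rewrite fmapM compcA k'E -compcA cE.
by apply: (kernel_mono kerk); rewrite cE kb -kd fmapM !compcA k'E.
Qed.

Lemma essential_transpose (K L : D) (u : Hom K L) (u' : Hom (H K) (H L)) :
  ε L ∘ fmap E u' = u ∘ ε K -> essential_mono u -> essential_mono u'.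
Proof.
move=> u'E [um u_ess]; split=> [Z a b ab|P h hm].
  apply: couniversal_inj; apply: um.
  by rewrite !compcA -u'E -!compcA -!fmapM ab.
have [εL' [εL'ε εεL']] := ε_iso L; have [εK' [εK'ε εεK']] := ε_iso K.
(* Precomposing [E h] with the inverse of [ε L] gives it the source [L], where the essentiality of
   [u] applies. *)
have Ehm : monomorphism (fmap E h ∘ εL').
  apply: u_ess; have -> : fmap E h ∘ εL' ∘ u = fmap E (h ∘ u') ∘ εK'.
    rewrite fmapM -!compcA; congr (_ ∘ _).
    by rewrite -[fmap E u']comp1c -εL'ε -[εL' ∘ _ ∘ _]compcA u'E -!compcA εεK' compc1.
  apply: mono_comp; first exact: fmap_mono.
  by apply: iso_mono; exists (ε K).
move=> Z a b hab; apply: couniversal_inj; apply: Ehm.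
by rewrite -!compcA ![εL' ∘ (_ ∘ _)]compcA εL'ε !comp1c -!fmapM hab.
Qed.

(** [E] need not be faithful, and the monomorphism [k] makes up for it: arrows into [K] can be
    compared after [k], and arrows into [H M] are determined by their images under [E]. *)
Lemma fmap_essential (K L : C) (M : D) (u : Hom K L) (k : Hom K (H M)) :
  monomorphism k -> essential_mono u -> essential_mono (fmap E u).
Proof.
move=> km [um u_ess]; split=> [|P h hum]; first exact: fmap_mono.
(* Up to the isomorphism [ε P], the arrow [h] is [E g] with [g] starting at [L], so the essentiality
   of [u] can be tested on [g]. *)
have [g [gE _]] := ε_univ h; rewrite -gE; apply: mono_comp.
  exact: iso_mono.
apply/fmap_mono/u_ess => Z a b guab; apply: km; apply: couniversal_inj.
rewrite !fmapM; do 2!congr (_ ∘ _); apply: hum.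
by rewrite -gE -!compcA -!fmapM !compcA guab.
Qed.

Theorem CSRickart_couniversal (M N : D) :
  CSRickart M N <-> CSRickart (H M) (H N).
Proof.
split=> [csr f'|csr f].
  have [εM' [εM'ε _]] := ε_iso M.
  (* Fullness of [H]: conjugating [E f'] by the counits gives the [f] whose image under [H] is
     [f']. *)
  pose f := ε N ∘ fmap E f' ∘ εM'.
  have f'E : ε N ∘ fmap E f' = f ∘ ε M by rewrite /f -!compcA εM'ε compc1.
  have [K [k [kerk [L [u [s [u_ess [s' s's] kE]]]]]]] := csr f.
  have [k' [k'E _]] := ε_univ (k ∘ ε K); have [u' [u'E _]] := ε_univ (u ∘ ε K).
  have [t [tE _]] := ε_univ (s ∘ ε L); have [t' [t'E _]] := ε_univ (s' ∘ ε M).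
  exists (H K), k'; split; first exact: kernel_transpose kerk.
  exists (H L), u', t; split.
  - exact: essential_transpose u_ess.
  - exists t'; apply: couniversal_inj.
    by rewrite fmapM compcA t'E -compcA tE compcA s's comp1c fmap1 compc1.
  - by apply: couniversal_inj; rewrite k'E kE fmapM compcA tE -!compcA u'E.
have [f' [f'E _]] := ε_univ (f ∘ ε M).
have [K [k [kerk [L [u [s [u_ess [s' s's] kE]]]]]]] := csr f'.
have [εM' [εM'ε εεM']] := ε_iso M.
(* [E k] lands in [E (H M)], and [ε M] identifies this object with [M]. *)
exists (E K), (ε M ∘ fmap E k); split; last first.
  exists (E L), (fmap E u), (ε M ∘ fmap E s); split.
  - exact: fmap_essential (kernel_mono kerk) u_ess.
  - exists (fmap E s' ∘ εM').
    by rewrite -compcA [εM' ∘ _]compcA εM'ε comp1c -fmapM s's fmap1.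
  - by rewrite kE fmapM compcA.
(* [E k] is a kernel of [E f'], and the isomorphisms [ε M] and [ε N] turn it into a kernel of
   [f]. *)
have [f'k kuniv] := fmap_kernel kerk.
have fε X (a : Hom X (E (H M))) : f ∘ (ε M ∘ a) = ε N ∘ (fmap E f' ∘ a).
  by rewrite compcA -f'E -compcA.
split=> [|X a fa]; first by rewrite fε f'k compc0.
have [|b [kb b_uniq]] := kuniv _ (εM' ∘ a).
  apply: (iso_mono (ε_iso N)).
  by rewrite -fε [ε M ∘ _]compcA εεM' comp1c fa compc0.
exists b; split=> [|c kc]; first by rewrite -compcA kb compcA εεM' comp1c.
by apply: b_uniq; rewrite -kc -!compcA [RHS]compcA εM'ε comp1c.
Qed.

End RightAdjoint.
End LeftAdjoint.
End UniversalArrows.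

(** * Duality *)

Program Definition opposite (C : category) : category :=
  @Category C (fun X Y => Hom Y X) (fun X => idc X) (fun X Y Z g f => compc f g)
    (fun X Y => zeroc Y X) _ _ _ _ _.
Next Obligation. by rewrite compcA. Qed.
Next Obligation. exact: compc1. Qed.
Next Obligation. exact: comp1c. Qed.
Next Obligation. exact: compc0. Qed.
Next Obligation. exact: comp0c. Qed.

Program Definition opposite_zfunctor (C D : category) (E : zfunctor C D) :
  zfunctor (opposite C) (opposite D) :=
  @ZFunctor (opposite C) (opposite D) E (fun X Y f => fmap E f) _ _ _.
Next Obligation. exact: fmap1. Qed.
Next Obligation. exact: fmapM. Qed.
Next Obligation. exact: fmap0. Qed.

Lemma dualCSRickart_opposite (C : category) (M N : C) :
  dualCSRickart M N <-> @CSRickart (opposite C) N M.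
Proof.
by split=> csr f; have [Q [q [cokq [P [r [t [? ? ?]]]]]]] := csr f;
  exists Q, q; split=> //; exists P, t, r; split.
Qed.

Section DualUniversalArrows.
Variables (C D : category) (E : zfunctor C D).
Hypothesis E_right_adjoint :
  forall N : D, exists (H : C) (ε : Hom (E H) N), couniversal_arrow ε.
Variables (F : D -> C) (η : forall N : D, Hom N (E (F N))).
Hypothesis η_univ : forall N, universal_arrow (η N).
Hypothesis η_iso : forall N, isomorphism (η N).

(** In the opposite categories [η] becomes couniversal, so [F] takes the place of [H], and
    [E_right_adjoint] provides the left adjoint. *)
Theorem dualCSRickart_universal (M N : D) :
  dualCSRickart M N <-> dualCSRickart (F M) (F N).
Proof.
rewrite !dualCSRickart_opposite.
apply: (@CSRickart_couniversal _ _ (opposite_zfunctor E) _ F η) => //.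
by move=> P; have [g [gη ηg]] := η_iso P; exists g.
Qed.

End DualUniversalArrows.

Local Open Scope ring_scope.

Lemma mod_isomorphism (A : pzRingType) (X Y : Mod A) (f : Hom X Y) (g : Y -> X) :
  cancel (f : {linear X -> Y}) g -> cancel g (f : {linear X -> Y}) -> isomorphism f.
Proof.
move=> fK gK; pose f' : {linear X -> Y} := f.
have gZ : linear g by exact: (can2_linear (f := f')).
pose h : {linear Y -> X} := HB.pack g (GRing.isLinear.Build _ _ _ _ g gZ).
by exists h; split; apply: linear_ext => x /=; [exact: fK | exact: gK].
Qed.

(** * The identity component as a functor from graded modules to [R_e]-modules *)

Section IdentityComponentModule.
Variables (G : groupType) (R : gradedRing G).

Lemma rproj_mulr x y : rcomp 1%g y -> forall σ, rproj σ (x * y) = rproj σ x * y :> R.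
Proof.
move=> y1 σ; elim/rcomp_ind: x => [|x z IHx IHz|τ x xτ].
- by rewrite mul0r rproj0 mul0r.
- by rewrite mulrDl !rprojD IHx IHz mulrDl.
have xyτ : rcomp τ (x * y) by rewrite -[τ]mulg1; apply: rcompM.
have [->|στ] := eqVneq σ τ; first by rewrite !rproj_id.
by rewrite (rproj_neq στ xyτ) (rproj_neq στ xτ) mul0r.
Qed.

Lemma Re_proj_subproof (x : R) : rproj 1%g x \in @Re_pred _ R.
Proof. by apply/asboolP; apply: rproj_in. Qed.

(** This is a map of [R_e]-bimodules. Its right linearity serves the inverse of the counit of
    [Coind], its left linearity the inverse of the unit of [Ind]. *)
Definition Re_proj (x : R) : Re R := MkRe (Re_proj_subproof x).

Lemma Re_projD : {morph Re_proj : x y / x + y}.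
Proof. by move=> x y; apply: val_inj; exact: rprojD. Qed.

Lemma Re_proj0 : Re_proj 0 = 0.
Proof. by apply: val_inj; exact: rproj0. Qed.

Lemma Re_proj_mull (a : Re R) x : Re_proj (val a * x) = a * Re_proj x.
Proof. by apply: val_inj; apply: rproj_mull; apply: Re_rcomp. Qed.

Lemma Re_proj_mulr (a : Re R) x : Re_proj (x * val a) = Re_proj x * a.
Proof. by apply: val_inj; apply: rproj_mulr; apply: Re_rcomp. Qed.

Lemma Re_proj_val (a : Re R) : Re_proj (val a) = a.
Proof. by apply: val_inj; apply: rproj_id; apply: Re_rcomp. Qed.

Lemma Re_proj_neq σ (x : R) : σ <> 1%g -> rcomp σ x -> Re_proj x = 0.
Proof.
by move=> /eqP σ1 xσ; apply: val_inj; apply: rproj_neq xσ; rewrite eq_sym.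
Qed.

Section Object.
Variable X : gradedModule R.

Lemma mcomp_subgroup (σ : G) : is_subgroup (@mcomp G R X σ).
Proof. by have [sX _ _] := mcomp_direct X. Qed.

Definition ecomp_pred : {pred X} := [pred m | `[< mcomp 1%g m >]].

Lemma ecomp_zmod_closed : zmod_closed ecomp_pred.
Proof.
have [s0 sB] := mcomp_subgroup 1%g.
split=> [|x y]; rewrite ?inE; first exact/asboolP.
by move=> /asboolP x1 /asboolP y1; apply/asboolP/sB.
Qed.

HB.instance Definition _ := GRing.isZmodClosed.Build X ecomp_pred ecomp_zmod_closed.

Record ecomp : Type := MkEcomp { ecomp_val : X; _ : ecomp_val \in ecomp_pred }.

HB.instance Definition _ := [isSub for ecomp_val].
HB.instance Definition _ := [Choice of ecomp by <:].
HB.instance Definition _ := [SubChoice_isSubZmodule of ecomp by <:].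

Lemma ecomp_mcomp (m : ecomp) : mcomp 1%g (val m).
Proof. by apply/asboolP; exact: (valP m). Qed.

Lemma ecomp_act_subproof (a : (Re R)^c) (m : ecomp) :
  val m ⋅ val (a : Re R) \in ecomp_pred.
Proof.
apply/asboolP; rewrite -[1%g]mulg1; apply: mcompM; first exact: ecomp_mcomp.
exact: Re_rcomp.
Qed.

Definition ecomp_act (a : (Re R)^c) (m : ecomp) : ecomp :=
  MkEcomp (ecomp_act_subproof a m).

Lemma ecomp_actA a b m : ecomp_act a (ecomp_act b m) = ecomp_act (a * b) m.
Proof. by apply: val_inj; rewrite /= ractA. Qed.

Lemma ecomp_act1 : left_id 1 ecomp_act.
Proof. by move=> m; apply: val_inj; rewrite /= ract1. Qed.

Lemma ecomp_actDr : right_distributive ecomp_act +%R.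
Proof. by move=> a m n; apply: val_inj; rewrite /= ractDl. Qed.

Lemma ecomp_actDl m : {morph ecomp_act^~ m : a b / a + b}.
Proof. by move=> a b; apply: val_inj; rewrite /= ractDr. Qed.

HB.instance Definition _ := GRing.Zmodule_isLmodule.Build (Re R)^c ecomp
  ecomp_actA ecomp_act1 ecomp_actDr ecomp_actDl.

Lemma val_ecomp_ract (m : ecomp) (a : Re R) : val (m ⋅ a) = val m ⋅ val a.
Proof. by []. Qed.

Lemma ecomp_proj_subproof (m : X) : dproj (mcomp_direct X) 1%g m \in ecomp_pred.
Proof. by apply/asboolP; apply: dproj_in. Qed.

(** It allows a map defined on [X_e] to be evaluated at any element of [X], as the transpose for
    [Coind] requires. *)
Definition ecomp_proj (m : X) : ecomp := MkEcomp (ecomp_proj_subproof m).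

Lemma ecomp_projD : {morph ecomp_proj : m n / m + n}.
Proof. by move=> m n; apply: val_inj; exact: dprojD. Qed.

Lemma ecomp_proj0 : ecomp_proj 0 = 0.
Proof. by apply: (addrI (ecomp_proj 0)); rewrite -ecomp_projD !addr0. Qed.

Lemma ecomp_proj_val (m : ecomp) : ecomp_proj (val m) = m.
Proof. by apply: val_inj; apply: dproj_id; apply: ecomp_mcomp. Qed.

Lemma ecomp_proj_neq σ (m : X) : σ <> 1%g -> mcomp σ m -> ecomp_proj m = 0.
Proof.
by move=> /eqP σ1 mσ; apply: val_inj; apply: dproj_neq mσ; rewrite eq_sym.
Qed.

Lemma mcomp_ind (P : X -> Prop) : P 0 -> (forall x y, P x -> P y -> P (x + y)) ->
  (forall σ x, mcomp σ x -> P x) -> forall x, P x.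
Proof.
move=> P0 PD Ph x; have [s [_ _ ->]] := dproj_sum (mcomp_direct X) x.
by apply: big_ind => // σ _; apply: Ph (dproj_in _ _ _).
Qed.

(** Multiplication by an element of [R_e] preserves degrees, so it suffices to compare both sides on
    homogeneous elements. *)
Lemma ecomp_proj_ract (m : X) (a : Re R) : ecomp_proj (m ⋅ val a) = ecomp_proj m ⋅ a.
Proof.
elim/mcomp_ind: m => [|m n IHm IHn|σ m mσ].
- by rewrite ract0l ecomp_proj0 ract0l.
- by rewrite ractDl !ecomp_projD IHm IHn ractDl.
have maσ : mcomp σ (m ⋅ val a) by rewrite -[σ]mulg1; apply/mcompM/Re_rcomp.
have [Eσ|/eqP σ1] := eqVneq σ 1%g; last first.
  by rewrite (ecomp_proj_neq σ1 mσ) (ecomp_proj_neq σ1 maσ) ract0l.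
rewrite Eσ in mσ maσ; apply: val_inj.
by rewrite val_ecomp_ract /= !dproj_id.
Qed.

End Object.

Section Morphism.
Variables (X Y : gradedModule R) (f : gr_hom X Y).

Lemma emap_subproof (m : ecomp X) : gr_map f (val m) \in @ecomp_pred Y.
Proof. by apply/asboolP; apply: gr_homP; apply: ecomp_mcomp. Qed.

Definition emap_fun (m : ecomp X) : ecomp Y := MkEcomp (emap_subproof m).

Lemma emap_linear : linear emap_fun.
Proof. by move=> a m n; apply: val_inj; rewrite /= linearP. Qed.

HB.instance Definition _ :=
  GRing.isLinear.Build (Re R)^c (ecomp X) (ecomp Y) _ emap_fun emap_linear.

Definition emap : {linear ecomp X -> ecomp Y} := emap_fun.

Lemma ecomp_proj_gr_hom (m : X) : ecomp_proj (gr_map f m) = emap (ecomp_proj m).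
Proof.
elim/mcomp_ind: m => [|m n IHm IHn|σ m mσ].
- by rewrite ecomp_proj0 !linear0 ecomp_proj0.
- by rewrite linearD !ecomp_projD IHm IHn linearD.
have fmσ := gr_homP f mσ; have [Eσ|/eqP σ1] := eqVneq σ 1%g.
  by rewrite Eσ in mσ fmσ; apply: val_inj; rewrite /= !dproj_id.
by rewrite (ecomp_proj_neq σ1 mσ) (ecomp_proj_neq σ1 fmσ) linear0.
Qed.

End Morphism.

Program Definition ecompF : zfunctor (gr R) (Mod (Re R)) :=
  @ZFunctor (gr R) (Mod (Re R)) (fun X => ecomp X : rmodType (Re R)) emap _ _ _.
Next Obligation. by apply: linear_ext => m; apply: val_inj. Qed.
Next Obligation. by apply: linear_ext => m; apply: val_inj. Qed.
Next Obligation. by apply: linear_ext => m; apply: val_inj. Qed.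

End IdentityComponentModule.

(** * Coinduction as right adjoint, with evaluation at 1 as counit *)

Section CoinductionAdjoint.
Variables (G : groupType) (R : gradedRing G).

Lemma coind_mulr (N : rmodType (Re R)) (φ : coind N) x (a : Re R) :
  val φ (x * val a) = val φ x ⋅ a.
Proof. exact: (coind_hom φ).2. Qed.

Lemma coind_ract (N : rmodType (Re R)) (φ : coind N) (r x : R) :
  val (φ ⋅ r) x = val φ (r * x).
Proof. by []. Qed.

Section Counit.
Variable N : rmodType (Re R).

Definition coind_eval1 (φ : ecomp (Coind N)) : N := val (val φ : coind N) 1.

Lemma coind_eval1_linear : linear coind_eval1.
Proof.
move=> a φ ψ; rewrite /coind_eval1 raddfD.
change (val (val φ ⋅ val (a : Re R) : coind N) 1 + coind_eval1 ψ =
  coind_eval1 φ ⋅ a + coind_eval1 ψ).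
by rewrite coind_ract mulr1 -[val a]mul1r coind_mulr.
Qed.

(** A component of degree [σ] different from the identity vanishes on [R_e], hence at 1, so
    evaluation at 1 only sees the identity component. *)
Lemma coind_eval1_proj (φ : Coind N) :
  coind_eval1 (ecomp_proj φ) = val (φ : coind N) 1.
Proof.
elim/mcomp_ind: φ => [|φ ψ IHφ IHψ|σ φ φσ].
- by rewrite ecomp_proj0.
- by rewrite ecomp_projD; have E := congr2 +%R IHφ IHψ; exact: E.
have [Eσ|/eqP σ1] := eqVneq σ 1%g.
  by rewrite Eσ in φσ; rewrite /coind_eval1 /= dproj_id.
rewrite (ecomp_proj_neq σ1 φσ); apply/esym/(φσ.2 1%g); last exact: rcomp1.
by move=> E; apply: σ1; rewrite -[σ]invgK -E invg1.
Qed.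

HB.instance Definition _ :=
  GRing.isLinear.Build (Re R)^c (ecomp (Coind N)) N _ coind_eval1 coind_eval1_linear.

Definition coind_counit : Hom (ecompF R (Coind N)) (N : Mod (Re R)) :=
  coind_eval1 : {linear ecomp (Coind N) -> N}.

(** This function is the preimage of [n] under evaluation at 1. *)
Lemma coind_eval_hcomp (n : N) :
  coind_hcomp 1%g (fun x : R => n ⋅ Re_proj x).
Proof.
split; first split=> [x y|x a].
- by rewrite Re_projD ractDr.
- by rewrite Re_proj_mulr ractA.
move=> σ x σ1 xσ; rewrite (Re_proj_neq _ xσ) ?ract0r // => E.
by apply: σ1; rewrite E invg1.
Qed.

Lemma coind_extend_subproof (n : N) :
  (fun x : R => n ⋅ Re_proj x) \in @coind_pred _ _ N.
Proof.
apply/asboolP; apply: (is_sum_of1 _ (coind_eval_hcomp n)).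
exact: coind_hcomp_subgroup.
Qed.

Lemma coind_extend_ecomp (n : N) :
  (MkCoind (coind_extend_subproof n) : Coind N) \in @ecomp_pred _ _ (Coind N).
Proof. by apply/asboolP; apply: coind_eval_hcomp. Qed.

Definition coind_extend (n : N) : ecomp (Coind N) :=
  MkEcomp (coind_extend_ecomp n).

(** An element [φ] of identity degree vanishes on every [R_σ] other than [R_e], and on [R_e] it
    satisfies [φ(x) = φ(1) x]. Hence its value at 1 determines it. *)
Lemma coind_counit_iso : isomorphism coind_counit.
Proof.
apply: (@mod_isomorphism _ _ _ _ coind_extend) => [φ|n] /=; last first.
  by rewrite /coind_eval1 /= (Re_proj_val (1 : Re R)) ract1.
apply/val_inj/val_inj/funext => x /=; have [φH φ0] := ecomp_mcomp φ.
elim/rcomp_ind: x => [|x y IHx IHy|σ x xσ].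
- rewrite Re_proj0 ract0r; apply: (addrI (val (val φ : coind N) 0)).
  by rewrite -φH.1 !addr0.
- by rewrite Re_projD ractDr IHx IHy -φH.1.
have [Eσ|/eqP σ1] := eqVneq σ 1%g; last first.
  rewrite (Re_proj_neq σ1 xσ) ract0r; apply/esym/(φ0 σ) => // E.
  by apply: σ1; rewrite E invg1.
by rewrite Eσ in xσ; rewrite -coind_mulr mul1r /= rproj_id.
Qed.

Section Transpose.
Variables (X : gradedModule R) (f : {linear ecomp X -> N}).

(** For [x] of degree [τ], the product [m ⋅ x] has degree [σ τ], which is the identity only for
    [τ = σ^-1]. This matches the inverse in the grading of [Coind]. *)
Lemma coind_transpose_hcomp σ (m : X) : mcomp σ m ->
  coind_hcomp σ (fun r : R => f (ecomp_proj (m ⋅ r))).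
Proof.
move=> mσ; split; first split=> [x y|x a].
- by rewrite ractDr ecomp_projD linearD.
- by rewrite -ractA ecomp_proj_ract linear_ract.
move=> τ x τσ xτ; rewrite (ecomp_proj_neq _ (mcompM mσ xτ)) ?linear0 // => E.
by apply: τσ; rewrite -[τ](mulKg σ) E mulg1.
Qed.

(** Since [m] is a finite sum of homogeneous elements, the function lies in the direct sum of the
    components and not merely in the full Hom group. *)
Lemma coind_transpose_subproof (m : X) :
  (fun r : R => f (ecomp_proj (m ⋅ r))) \in @coind_pred _ _ N.
Proof.
apply/asboolP; have sS := is_sum_of_subgroup (@coind_hcomp_subgroup _ _ N).
elim/mcomp_ind: m => [|m n IHm IHn|σ m mσ].
- have -> : (fun r : R => f (ecomp_proj ((0 : X) ⋅ r))) = 0.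
    by apply/funext => r; rewrite ract0l ecomp_proj0 linear0.
  exact: sS.1.
- have -> : (fun r : R => f (ecomp_proj ((m + n) ⋅ r))) =
      (fun r => f (ecomp_proj (m ⋅ r))) + (fun r => f (ecomp_proj (n ⋅ r))).
    by apply/funext => r; rewrite ractDl ecomp_projD linearD.
  exact: is_subgroupD.
apply: (is_sum_of1 _ (coind_transpose_hcomp mσ)).
exact: coind_hcomp_subgroup.
Qed.

Definition coind_transpose_fun (m : X) : Coind N :=
  MkCoind (coind_transpose_subproof m).

Lemma coind_transpose_linear : linear coind_transpose_fun.
Proof.
move=> r m n; apply/val_inj/funext => x.
change (f (ecomp_proj ((m ⋅ (r : R) + n) ⋅ x)) =
  f (ecomp_proj (m ⋅ ((r : R) * x))) + f (ecomp_proj (n ⋅ x))).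
by rewrite ractDl ecomp_projD linearD ractA.
Qed.

HB.instance Definition _ :=
  GRing.isLinear.Build R^c X (Coind N) _ coind_transpose_fun coind_transpose_linear.

Definition coind_transpose : gr_hom X (Coind N) :=
  @GrHom _ _ X (Coind N) (coind_transpose_fun : {linear X -> Coind N})
    (fun σ m mσ => coind_transpose_hcomp mσ).

End Transpose.

Lemma coind_counit_couniversal : couniversal_arrow coind_counit.
Proof.
move=> X f; exists (coind_transpose (f : {linear ecomp X -> N})).
split=> [|g gf].
  apply: linear_ext => m /=.
  by rewrite /coind_eval1 /= ract1 ecomp_proj_val.
(* Uniqueness: [g(m)(r) = (g(m) r)(1) = g(m r)(1)], and evaluation at 1 depends only on the identity
   component of [g(m r)], where [g] is prescribed by [f]. *)
apply: gr_hom_ext => m; apply/val_inj/funext => r /=.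
rewrite -gf /= -ecomp_proj_gr_hom coind_eval1_proj.
by rewrite linear_ract coind_ract mulr1.
Qed.

End Counit.
End CoinductionAdjoint.

(** * Induction as left adjoint, with [n ↦ n ⊗ 1] as unit *)

Section InductionAdjoint.
Variables (G : groupType) (R : gradedRing G) (N : rmodType (Re R)).

Lemma ind_ract (n : N) (x r : R) :
  (n ⊗ (x : leftRe R) : ind N) ⋅ r = n ⊗ (x * r : leftRe R).
Proof. exact: ind_act_tmk. Qed.

Lemma tmk_Re (n : N) (a : Re R) (x : R) :
  n ⊗ (val a * x : leftRe R) = (n ⋅ a) ⊗ (x : leftRe R).
Proof. by rewrite tmkA. Qed.

Lemma ind_unit_subproof (n : N) :
  (n ⊗ (1 : leftRe R) : Ind N) \in @ecomp_pred _ _ (Ind N).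
Proof. by apply/asboolP; apply: ind_comp_tmk; apply: rcomp1. Qed.

Definition ind_unit_fun (n : N) : ecomp (Ind N) := MkEcomp (ind_unit_subproof n).

Lemma ind_unit_linear : linear ind_unit_fun.
Proof.
move=> a m n; apply: val_inj.
change ((m ⋅ (a : Re R) + n) ⊗ (1 : leftRe R) =
  (m ⊗ (1 : leftRe R) : ind N) ⋅ val (a : Re R) + n ⊗ (1 : leftRe R)).
by rewrite tmkDl -tmk_Re ind_ract mulr1 mul1r.
Qed.

HB.instance Definition _ :=
  GRing.isLinear.Build (Re R)^c N (ecomp (Ind N)) _ ind_unit_fun ind_unit_linear.

Definition ind_unit : Hom (N : Mod (Re R)) (ecompF R (Ind N)) :=
  ind_unit_fun : {linear N -> ecomp (Ind N)}.

Let γ (n : N) (x : leftRe R) : N := n ⋅ Re_proj (x : R).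

Let γDl n n' x : γ (n + n') x = γ n x + γ n' x.
Proof. exact: ractDl. Qed.

Let γDr n x x' : γ n (x + x') = γ n x + γ n x'.
Proof. by rewrite /γ Re_projD ractDr. Qed.

Let γA n a x : γ (n ⋅ a) x = γ n (a *: x).
Proof. by rewrite /γ [Re_proj (a *: x)]Re_proj_mull ractA. Qed.

(** A retraction of the unit defined on all of [N ⊗ R]; it inverts the unit once restricted to the
    identity component. *)
Definition ind_contract (t : ind N) : N := tensor_lift γ t.

Lemma ind_contract_tmk n (x : leftRe R) :
  ind_contract (n ⊗ x) = n ⋅ Re_proj (x : R).
Proof. by rewrite /ind_contract tensor_lift_tmk. Qed.

Lemma ind_contractD : {morph ind_contract : t u / t + u}.
Proof. exact: tensor_liftD. Qed.

(** On pure tensors this is the balancing relation: the identity component of [x] lies in [R_e] and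
    moves across the tensor sign. *)
Lemma tmk_ind_contract (t : ind N) :
  ind_contract t ⊗ (1 : leftRe R) = ind_proj 1%g t.
Proof.
move: t; apply: (@tensor_ext _ N (leftRe R)) => [t u|t u|n x].
- by rewrite ind_contractD tmkDl.
- exact: ind_projD.
by rewrite ind_contract_tmk ind_proj_tmk -tmk_Re mulr1.
Qed.

Lemma ind_unit_iso : isomorphism ind_unit.
Proof.
apply: (@mod_isomorphism _ _ _ _ (fun t : ecomp (Ind N) => ind_contract (val t))) => [n|t].
  by rewrite [LHS]ind_contract_tmk (Re_proj_val (1 : Re R)) ract1.
(* It remains to see that [ind_proj 1%g] fixes [t], which is a sum of pure tensors with second
   factor in [R_e]. *)
apply: val_inj; rewrite /= tmk_ind_contract; have [s [s1 ->]] := ecomp_mcomp t.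
rewrite (big_morph _ (@ind_projD _ _ N 1%g) (@ind_proj0 _ _ N 1%g)) !big_seq.
by apply: eq_bigr => p ps; rewrite ind_proj_tmk rproj_id //; apply: s1.
Qed.

Section Transpose.
Variables (X : gradedModule R) (f : {linear N -> ecomp X}).

Let β (n : N) (x : leftRe R) : X := val (f n) ⋅ (x : R).

Let βDl n n' x : β (n + n') x = β n x + β n' x.
Proof. by rewrite /β linearD -ractDl. Qed.

Let βDr n x x' : β n (x + x') = β n x + β n x'.
Proof. exact: ractDr. Qed.

Let βA n a x : β (n ⋅ a) x = β n (a *: x).
Proof. by rewrite /β linear_ract val_ecomp_ract ractA. Qed.

Definition ind_transpose_fun (t : Ind N) : X := tensor_lift β (t : ind N).

Lemma ind_transpose_tmk n (x : leftRe R) :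
  ind_transpose_fun (n ⊗ x) = val (f n) ⋅ (x : R).
Proof. by rewrite /ind_transpose_fun tensor_lift_tmk. Qed.

Lemma ind_transposeD : {morph ind_transpose_fun : t u / t + u}.
Proof. exact: tensor_liftD. Qed.

Lemma ind_transpose_linear : linear ind_transpose_fun.
Proof.
move=> r t u; rewrite ind_transposeD; congr (_ + _).
move: t; apply: (@tensor_ext _ N (leftRe R)) => [t t'|t t'|n x].
- by rewrite scalerDr ind_transposeD.
- by rewrite ind_transposeD scalerDr.
change (ind_transpose_fun ((n ⊗ x : ind N) ⋅ (r : R)) =
  ind_transpose_fun (n ⊗ x) ⋅ (r : R)).
by rewrite ind_ract !ind_transpose_tmk ractA.
Qed.

HB.instance Definition _ :=
  GRing.isLinear.Build R^c (Ind N) X _ ind_transpose_fun ind_transpose_linear.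

(** [f n] has identity degree, so its product with an element of [R_σ] has degree [σ]. *)
Lemma ind_transpose_mcomp σ (t : Ind N) :
  mcomp σ t -> mcomp σ ((ind_transpose_fun : {linear Ind N -> X}) t).
Proof.
move=> [s [sσ ->]]; rewrite linear_sum big_seq.
apply: (big_ind (mcomp σ)).
- exact: (mcomp_subgroup X σ).1.
- by move=> x y; apply: is_subgroupD; apply: mcomp_subgroup.
move=> [n x] /sσ xσ; rewrite /= ind_transpose_tmk -[σ]mul1g.
by apply: mcompM xσ; apply: ecomp_mcomp.
Qed.

Definition ind_transpose : gr_hom (Ind N) X := GrHom ind_transpose_mcomp.

End Transpose.

Lemma ind_unit_universal : universal_arrow ind_unit.
Proof.
move=> X f; exists (ind_transpose (f : {linear N -> ecomp X})).
split=> [|g gf].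
  apply: linear_ext => n; apply: val_inj => /=.
  by rewrite ind_transpose_tmk ract1.
apply: gr_hom_ext.
apply: (@tensor_ext _ N (leftRe R)) => [t u|t u|n x] /=.
- exact: linearD.
- exact: linearD.
(* Uniqueness: [n ⊗ x = (n ⊗ 1) x], so the values of [g] on the image of the unit determine it by
   [R]-linearity. *)
rewrite ind_transpose_tmk -gf /=.
rewrite -[RHS]/(gr_map g (n ⊗ x)) -[x in RHS]mul1r -ind_ract.
by rewrite linear_ract.
Qed.

End InductionAdjoint.

Theorem corollary4p6 (G : groupType) (R : gradedRing G)
    (M N : rmodType (Re R)) :
  (@CSRickart (Mod (Re R)) M N <-> @CSRickart (gr R) (Coind M) (Coind N)) /\
  (@dualCSRickart (Mod (Re R)) M N <-> @dualCSRickart (gr R) (Ind M) (Ind N)).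
Proof.
split.
  (* [Coind] plays the role of [H]; [Ind] provides the left adjoint through which [ecompF] preserves
     monomorphisms and kernels. In the second half the two exchange roles. *)
  apply: (CSRickart_couniversal (E := ecompF R) _
    (@coind_counit_couniversal G R) (@coind_counit_iso G R)).
  by move=> P; exists (Ind P), (ind_unit P); apply: ind_unit_universal.
apply: (dualCSRickart_universal (E := ecompF R) _
  (@ind_unit_universal G R) (@ind_unit_iso G R)).
by move=> P; exists (Coind P), (coind_counit P); apply: coind_counit_couniversal.
Qed.
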